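(* Let $\mathbf F=(f_1,\dots,f_n):\mathbb R^n\times\mathbb R^r\to\mathbb R^n$, $\mathbf F=\mathbf F(\mathbf x;\boldsymbol\alpha)$, be smooth, with $\mathbf F(0;0)=0$ and $\operatorname{subrank}\mathbf F(0;0)=n-1$. Then an underlying catastrophe of codimension $r$ at $(0;0)$, given by $\mathcal B_1(0;0)=\dots=\mathcal B_r(0;0)=0$, is equivalent to a Thom-Boardman singularity with Boardman symbol $\tau=1,\dots,1$ of length $r$. That is, $\mathcal B_1(0;0)=\dots=\mathcal B_r(0;0)=0$ if and only if $\mathbf F$ has, at $\mathbf x=0$ (with $\boldsymbol\alpha=0$), Boardman symbol $\tau=\tau_1,\dots,\tau_r$ with $\tau_1=\dots=\tau_r=1$ and $\tau_{r+1}=0$.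
   Context: Notation: $\mathbf x=(x_1,\dots,x_n)\in\mathbb R^n$ are variables, $\boldsymbol\alpha\in\mathbb R^r$ parameters ($r\ge1$), and $\nabla=\partial/\partial\mathbf x$ is the derivative with respect to $\mathbf x$ only (parameters fixed). For a tuple of functions $(g_1,\dots,g_m)$, $\nabla(g_1,\dots,g_m)$ is the $m\times n$ matrix with rows $\nabla g_1,\dots,\nabla g_m$. Subrank: $\operatorname{subrank}\mathbf F(0;0)$ is the least number of dimensions spanned by any $n-1$ of the gradient vectors $\nabla f_1(0;0),\dots,\nabla f_n(0;0)$. So $\operatorname{subrank}\mathbf F(0;0)=n-1$ means that any $n-1$ of these gradient vectors are linearly independent. $\mathcal B$ determinants: $\mathcal B_0=f_1$ and, for $i\ge 1$, $\mathcal B_i=\det\nabla(\mathcal B_{i-1},f_2,\dots,f_n)$, as functions of $(\mathbf x;\boldsymbol\alpha)$. Underlying catastrophe: $\mathbf F$ exhibits an underlying catastrophe of codimension $r$ at a point of $\mathbb R^n\times\mathbb R^r$ if $\mathbf F=0$ and $\mathcal B_1=\dots=\mathcal B_r=0$ there. Boardman symbol at $\mathbf x=0$ (with $\boldsymbol\alpha=0$ fixed): the corank of an $m\times n$ matrix with $m\ge n$ is $n$ minus its rank. For a finite tuple $G=(g_1,\dots,g_m)$ of smooth functions of $\mathbf x$ and an integer $i\ge 1$, let $\Delta^i G$ be the tuple obtained by appending to $G$ all the $(n-i+1)\times(n-i+1)$ minors of the matrix $\nabla G$ (as functions of $\mathbf x$). The Boardman symbol of $\mathbf F$ at $\mathbf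 x=0$ is the sequence $\tau=\tau_1,\dots,\tau_r$ such that $\nabla\mathbf F(0)$ has corank $\tau_1$ and $\nabla(\Delta^{\tau_{j-1}}\cdots\Delta^{\tau_1}\mathbf F)(0)$ has corank $\tau_j$ for $j=2,\dots,r$, where the symbol is taken to terminate at the $r$ such that $\tau_{r+1}=0$.
   Formalization: B_1=…=B_r=0 does not force τ_{r+1}=0 (n=1, F=x^{r+2}); proved instead: B_1=…=B_r=0 iff τ_1=…=τ_r=1, and B_1=…=B_r=0 with B_{r+1}≠0 at (0;0) iff the symbol is 1,…,1 (length r) with τ_{r+1}=0. *)

(* Defs.v *)
From mathcomp Require Import all_boot all_order all_algebra.
From mathcomp Require Import all_classical all_reals all_analysis.

Set Implicit Arguments.
Unset Strict Implicit.
Unset Printing Implicit Defensive.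

Import Order.TTheory GRing.Theory Num.Theory.
Import numFieldNormedType.Exports.

Local Open Scope classical_set_scope.
Local Open Scope ring_scope.

Section Smooth.
Variables (R : realType) (V W : normedModType R).

(* f is C^k: the directional derivatives of a differentiable f along all
   vectors v are the components of its Frechet derivative. *)
Fixpoint Ck (k : nat) (f : V -> W) : Prop :=
  if k is k'.+1
  then (forall x, differentiable f x) /\ (forall v, Ck k' ('D_v f))
  else continuous f.

Definition smooth (f : V -> W) : Prop := forall k, Ck k f.

End Smooth.

Section Nabla.
Variables (R : realType) (n : nat).

Definition nabla m (g : 'I_m -> 'rV[R]_n -> R) (x : 'rV[R]_n) : 'M[R]_(m, n) :=
  \matrix_(a < m, j < n) 'D_(delta_mx ord0 j) (g a) x.

End Nabla.

Section Boardman.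
Variables (R : realType) (n : nat).
Implicit Type G : seq ('rV[R]_n -> R).

Definition nabla_tuple G : 'rV[R]_n -> 'M[R]_(size G, n) :=
  nabla (tnth (in_tuple G)).

Definition increasing_maps k m : seq {ffun 'I_k -> 'I_m} :=
  [seq s : {ffun 'I_k -> 'I_m} <- enum {ffun 'I_k -> 'I_m} |
    [forall a : 'I_k, forall b : 'I_k, (a < b)%N ==> (s a < s b)%N]].

Definition minors k G : seq ('rV[R]_n -> R) :=
  [seq (fun x => \det (mxsub s t (nabla_tuple G x)))
    | s : {ffun 'I_k -> 'I_(size G)} <- increasing_maps k (size G),
      t : {ffun 'I_k -> 'I_n} <- increasing_maps k n].

Definition Delta (i : nat) G : seq ('rV[R]_n -> R) :=
  G ++ minors (n - i + 1)%N G.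

Definition corank0 G : nat := (n - \rank (nabla_tuple G 0))%N.

(* Deltas G [:: t_1; ...; t_j] is Delta^{t_j} ... Delta^{t_1} G *)
Definition Deltas G (tau : seq nat) : seq ('rV[R]_n -> R) :=
  foldl (fun H i => Delta i H) G tau.

(* The entries of tau (stored from index 0) are the first size tau entries of
   the Boardman symbol of G at 0, which may continue beyond them. *)
Definition boardman_begins G (tau : seq nat) : Prop :=
  forall j, (j < size tau)%N ->
    corank0 (Deltas G (take j tau)) = nth 0%N tau j.

Definition boardman_symbol G (tau : seq nat) : Prop :=
  [/\ all (fun t => 0 < t)%N tau, boardman_begins G tau
    & corank0 (Deltas G tau) = 0%N].

End Boardman.

Section Catastrophe.
Variables (R : realType) (n r : nat).
Variable F : 'rV[R]_n.+1 * 'rV[R]_r -> 'rV[R]_n.+1.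

Definition component (i : 'I_n.+1) (p : 'rV[R]_n.+1 * 'rV[R]_r) : R := F p ord0 i.

Definition nabla_x m (g : 'I_m -> 'rV[R]_n.+1 * 'rV[R]_r -> R)
    (p : 'rV[R]_n.+1 * 'rV[R]_r) : 'M[R]_(m, n.+1) :=
  nabla (fun a x => g a (x, p.2)) p.1.

(* The dimension is n.+1, and row' i discards the i-th of the n.+1 gradients.
   Each rank is at most n, so the initial value n does not affect the minimum. *)
Definition subrank (p : 'rV[R]_n.+1 * 'rV[R]_r) : nat :=
  \big[minn/n]_(i < n.+1) \rank (row' i (nabla_x component p)).

Fixpoint Bdet (i : nat) : 'rV[R]_n.+1 * 'rV[R]_r -> R :=
  if i is i'.+1
  then fun p => \det (nabla_x (fun a => if a == ord0 then Bdet i' else component a) p)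
  else component ord0.

Definition underlying_catastrophe (p : 'rV[R]_n.+1 * 'rV[R]_r) : Prop :=
  F p = 0 /\ forall i, (1 <= i <= r)%N -> Bdet i p = 0.

Definition F_at0 : seq ('rV[R]_n.+1 -> R) :=
  [seq (fun x => component i (x, 0)) | i <- enum 'I_n.+1].

End Catastrophe.

(* Main.v *)
Require Import Defs.
From mathcomp Require Import all_boot all_order all_algebra perm zify.
From mathcomp Require Import all_classical all_reals all_analysis.
Import numFieldNormedType.Exports.
Local Open Scope ring_scope.
Import GRing.Theory.

(** Write D g = det (grad g, grad f_2, ..., grad f_n), a derivation killing
f_2, ..., f_n, so that B_i = D^i f_1 at alpha = 0. Since the gradients of
f_2, ..., f_n are independent at 0, a tuple containing them has corank at most
1 there, and corank 1 iff D g (0) = 0 for all its members g.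
As germs at 0, the functions in Delta^1 ... Delta^1 F (j times) generate the
same ideal as f_2, ..., f_n, B_0, ..., B_j: multiplying nabla (g_1, ..., g_n)
by the adjugate of an invertible matrix with last rows grad f_2, ..., grad f_n
produces a matrix with first column D g_1, ..., D g_n, so every maximal minor
lies in the ideal of the D g_a; conversely D g is itself, up to sign, a minor
or zero. Hence, when B_1, ..., B_j vanish at 0, the corank at step j is 1 if
B_(j+1) vanishes at 0, and 0 otherwise. *)

(** * Closure properties of smooth maps *)

Section Smooth.
Set Implicit Arguments.
Unset Strict Implicit.
Variables (R : realType).
Implicit Types V W Z : normedModType R.

Lemma CkW V W k (f : V -> W) : Ck k.+1 f -> Ck k f.
Proof.
elim: k f => [|k IH] f [df dvf]; first by move=> x; apply/differentiable_continuous/df.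
by split=> // v; apply: IH; exact: dvf.
Qed.

Lemma smooth_differentiable V W (f : V -> W) x : smooth f -> differentiable f x.
Proof. by move=> /(_ 1%N)[]. Qed.

Lemma smooth_derivable V W (f : V -> W) x v : smooth f -> derivable f x v.
Proof. by move=> sf; apply/diff_derivable/smooth_differentiable. Qed.

Lemma smooth_derive V W (f : V -> W) v : smooth f -> smooth ('D_v f).
Proof. by move=> sf k; have [_] := sf k.+1; apply. Qed.

Lemma Ck_cst V W k (c : W) : Ck k (fun _ : V => c).
Proof.
elim: k c => [|k IH] c; first exact: cst_continuous.
split=> [x|v]; first exact: differentiable_cst.
have -> : 'D_v (fun _ : V => c) = fun=> 0 by apply/funext => x; exact: derive_cst.
exact: IH.
Qed.

Lemma smooth_cst V W (c : W) : smooth (fun _ : V => c).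
Proof. by move=> k; exact: Ck_cst. Qed.

Lemma smooth_id V : smooth (fun x : V => x).
Proof.
case=> [x|k]; first exact: cvg_id.
split=> [x|v]; first by [].
have -> : 'D_v (fun x : V => x) = fun=> v by apply/funext => x; exact: derive_id.
exact: Ck_cst.
Qed.

Lemma CkD V W k (f g : V -> W) : Ck k f -> Ck k g -> Ck k (fun x => f x + g x).
Proof.
elim: k f g => [|k IH] f g; first by move=> cf cg x; exact: cvgD (cf x) (cg x).
move=> [df dvf] [dg dvg]; split=> [x|v]; first exact: differentiableD.
have -> : 'D_v (fun x => f x + g x) = fun x => 'D_v f x + 'D_v g x.
  by apply/funext => x; rewrite -deriveD //; exact: diff_derivable.
by apply: IH; [exact: dvf|exact: dvg].
Qed.

Lemma derive_mul V (f g : V -> R) x v : derivable f x v -> derivable g x v ->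
  'D_v (fun y => f y * g y) x = f x * 'D_v g x + 'D_v f x * g x.
Proof. by move=> df dg; rewrite [LHS]deriveM // [in RHS](mulrC _ (g x)). Qed.

Lemma CkM V k (f g : V -> R) : Ck k f -> Ck k g -> Ck k (fun x => f x * g x).
Proof.
elim: k f g => [|k IH] f g; first by move=> cf cg x; exact: cvgM (cf x) (cg x).
move=> Cf Cg; have [df dvf] := Cf; have [dg dvg] := Cg.
split=> [x|v]; first exact: differentiableM.
have -> : 'D_v (fun x => f x * g x) = fun x => f x * 'D_v g x + 'D_v f x * g x.
  by apply/funext => x; rewrite derive_mul //; exact: diff_derivable.
by apply: CkD; apply: IH; [exact: CkW|exact: dvg|exact: dvf|exact: CkW].
Qed.

Lemma smoothD V W (f g : V -> W) : smooth f -> smooth g -> smooth (fun x => f x + g x).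
Proof. by move=> sf sg k; exact: CkD. Qed.

Lemma smoothM V (f g : V -> R) : smooth f -> smooth g -> smooth (fun x => f x * g x).
Proof. by move=> sf sg k; exact: CkM. Qed.

Lemma smooth_sum V W (I : Type) (s : seq I) (P : pred I) (f : I -> V -> W) :
  (forall i, smooth (f i)) -> smooth (fun x => \sum_(i <- s | P i) f i x).
Proof.
move=> sf; elim: s => [|i s IH].
  rewrite (_ : (fun=> _) = fun=> 0); first exact: smooth_cst.
  by apply/funext => x; rewrite big_nil.
rewrite (_ : (fun=> _) =
  fun x => (if P i then f i x else 0) + \sum_(j <- s | P j) f j x).
  by apply: smoothD => //; case: (P i); [exact: sf|exact: smooth_cst].
by apply/funext => x; rewrite big_cons; case: ifP; rewrite ?add0r.
Qed.

Lemma smooth_prod V (I : Type) (s : seq I) (f : I -> V -> R) :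
  (forall i, smooth (f i)) -> smooth (fun x => \prod_(i <- s) f i x).
Proof.
move=> sf; elim: s => [|i s IH].
  rewrite (_ : (fun=> _) = fun=> 1); first exact: smooth_cst.
  by apply/funext => x; rewrite big_nil.
rewrite (_ : (fun=> _) = fun x => f i x * \prod_(j <- s) f j x); first exact: smoothM.
by apply/funext => x; rewrite big_cons.
Qed.

Lemma smooth_det V m (M : V -> 'M[R]_m) :
  (forall i j, smooth (fun x => M x i j)) -> smooth (fun x => \det (M x)).
Proof.
move=> sM; rewrite /determinant; apply: smooth_sum => s.
by apply: smoothM; [exact: smooth_cst|apply: smooth_prod => i; exact: sM].
Qed.

Lemma smooth_cofactor V m (M : V -> 'M[R]_m) i j :
  (forall i j, smooth (fun x => M x i j)) -> smooth (fun x => cofactor (M x) i j).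
Proof.
move=> sM; apply: smoothM; first exact: smooth_cst.
apply: smooth_det => a b.
rewrite (_ : (fun=> _) = fun x => M x (lift i a) (lift j b)) //.
by apply/funext => x; rewrite !mxE.
Qed.

(** The induction closes because a derivative of the slice along [v] is the slice of the derivative
    of [F] along [(v, 0)]. *)
Lemma Ck_slice V W Z k (F : V * Z -> W) (z : Z) :
  Ck k F -> Ck k (fun x => F (x, z)).
Proof.
have dz x : differentiable (fun y : V => (y, z)) x.
  by apply: differentiable_pair => //; exact: differentiable_cst.
elim: k F => [|k IH] F.
  move=> cF x; apply: (@continuous_comp _ _ _ (fun y : V => (y, z)) F) => //.
    exact/differentiable_continuous/dz.
  exact: cF.
move=> [dF dvF]; split=> [x|v]; first exact: (@differentiable_comp _ _ _ _ (fun y : V => (y, z)) F).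
have -> : 'D_v (fun x => F (x, z)) = fun x => 'D_(v, 0) F (x, z).
  apply/funext => x; rewrite /derive; apply: (congr1 (fun g : R -> W => lim (g @ 0^')%classic)).
  apply/funext => h /=; congr (_ *: (F _ - _)).
  by congr pair; rewrite /= scaler0 add0r.
exact: (IH ('D_(v, 0) F) (dvF (v, 0))).
Qed.

Lemma Ck_entry V k m n (F : V -> 'M[R]_(m, n)) i j :
  Ck k F -> Ck k (fun x => F x i j).
Proof.
have dc M : differentiable (fun N : 'M[R]_(m, n) => N i j) M by exact: differentiable_coord.
elim: k F => [|k IH] F.
  move=> cF x; apply: (@continuous_comp _ _ _ F (fun N : 'M[R]_(m, n) => N i j)) => //.
    exact: cF.
  exact/differentiable_continuous/dc.
move=> [dF dvF]; split=> [x|v]; first exact: (@differentiable_comp _ _ _ _ F (fun N : 'M[R]_(m, n) => N i j)).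
have -> : 'D_v (fun x => F x i j) = fun x => 'D_v F x i j.
  apply/funext => x.
  by rewrite derive_mx ?mxE //; exact: diff_derivable.
exact: (IH ('D_v F) (dvF v)).
Qed.

Lemma smooth_slice_entry V Z m n (F : V * Z -> 'M[R]_(m, n)) (z : Z) i j :
  smooth F -> smooth (fun x => F (x, z) i j).
Proof. by move=> sF k; exact: (Ck_entry i j (Ck_slice z (sF k))). Qed.

End Smooth.

(** * Sorting the index selections of minors *)

Section Increasing.
Set Implicit Arguments.
Unset Strict Implicit.

Lemma mem_increasing_maps k m (s : {ffun 'I_k -> 'I_m}) :
  (forall a b : 'I_k, (a < b)%N -> (s a < s b)%N) -> s \in increasing_maps k m.
Proof.
move=> incs; rewrite mem_filter mem_enum inE andbT.
by apply/forallP => a; apply/forallP => b; apply/implyP/incs.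
Qed.

(* The permutation sends a to the number of values of s below s a. *)
Lemma increasing_rearrangement k m (s : 'I_k -> 'I_m) : injective s ->
  exists (p : {perm 'I_k}) (t : {ffun 'I_k -> 'I_m}),
    t \in increasing_maps k m /\ forall a, s a = t (p a).
Proof.
move=> injs; pose B a := [set b | (s b < s a)%N].
have Blt a : (#|B a| < k)%N.
  rewrite -[X in (_ < X)%N]card_ord -cardsT; apply/proper_card/properP; split=> //.
  by exists a; rewrite !inE ?ltnn.
have BS a b : (s a < s b)%N -> (#|B a| < #|B b|)%N.
  move=> ab; apply/proper_card/properP; split; last by exists a; rewrite !inE ?ltnn.
  by apply/fintype.subsetP => c; rewrite !inE => /ltn_trans; apply.
pose rk a := Ordinal (Blt a).
have rk_inj : injective rk.
  move=> a b /(congr1 val) /= eB; apply: injs; apply/val_inj.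
  by case: (ltngtP (s a) (s b)) => // /BS; rewrite eB ltnn.
pose p := perm rk_inj; pose q : {perm 'I_k} := (p^-1)%g.
exists p, [ffun a => s (q a)]; split; last by move=> a; rewrite ffunE permK.
apply: mem_increasing_maps => a b ab; rewrite !ffunE.
(* Through [q], the hypothesis [a < b] compares the cardinalities of [B (q a)] and [B (q b)], and
   [BS] then excludes the reverse order of the values of [s]. *)
rewrite -(permKV p a) -(permKV p b) -/q ![p _]permE /= in ab.
case: (ltngtP (s (q a)) (s (q b))) => // [/BS|/val_inj/injs e].
  by rewrite ltnNge (ltnW ab).
by rewrite e ltnn in ab.
Qed.

End Increasing.

(** * Bordering a matrix of full row rank *)

Section LinearAlgebra.
Set Implicit Arguments.
Unset Strict Implicit.
Variables (K : fieldType) (n : nat).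

(** The rank of the bordered matrix is [n] or [n.+1]: a row outside the row space of [M] raises it
    to [n.+1], which means invertibility. *)
Lemma det_col_mx_eq0 (u : 'rV[K]_n.+1) (M : 'M[K]_(n, n.+1)) :
  \rank M = n -> (\det (col_mx u M : 'M[K]_n.+1) == 0) = (u <= M)%MS.
Proof.
move=> rM; have := mxrank_leqif_sup (addsmxSr u M).
rewrite addsmx_sub submx_refl andbT rM => -[le <-].
have := rank_leq_col (u + M)%MS.
have -> : (\det (col_mx u M : 'M[K]_n.+1) == 0) = (\rank (u + M)%MS != n.+1).
  have := row_free_unit (col_mx u M : 'M[K]_n.+1).
  by rewrite unitmxE unitfE addsmxE /row_free => ->; rewrite negbK.
by lia.
Qed.
End LinearAlgebra.

(** * Ideals of germs at 0 *)

Section GermIdeal.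
Set Implicit Arguments.
Unset Strict Implicit.
Variables (R : realType) (V : normedModType R).
Implicit Types (S T : (V -> R) -> Prop) (g h u a : V -> R).

(* The last rule makes this the ideal of germs at 0, expressed with globally
   defined functions: one may divide by a function not vanishing at 0. *)
Inductive germ_ideal S : (V -> R) -> Prop :=
| germ_ideal_gen g : S g -> germ_ideal S g
| germ_ideal0 : germ_ideal S (fun=> 0)
| germ_idealD g h : germ_ideal S g -> germ_ideal S h ->
    germ_ideal S (fun x => g x + h x)
| germ_idealM a g : smooth a -> germ_ideal S g -> germ_ideal S (fun x => a x * g x)
| germ_ideal_div u g : smooth u -> u 0 != 0 -> smooth g ->
    germ_ideal S (fun x => u x * g x) -> germ_ideal S g.

(** In the division rule smoothness has to come from the premise on [g]: where [u] vanishes, the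
    product does not determine [g]. *)
Lemma germ_ideal_smooth S g :
  (forall s, S s -> smooth s) -> germ_ideal S g -> smooth g.
Proof.
move=> sS; elim=> // [|*|*]; [exact: smooth_cst|exact: smoothD|exact: smoothM].
Qed.

Lemma germ_ideal_eq0 S g :
  (forall s, S s -> s 0 = 0) -> germ_ideal S g -> g 0 = 0.
Proof.
move=> S0; elim=> // [h k _ h0 _ k0|a h _ _ h0|u h _ u0 _ _ /eqP].
- by rewrite h0 k0 addr0.
- by rewrite h0 mulr0.
- by rewrite mulf_eq0 (negbTE u0) => /eqP.
Qed.

Lemma germ_ideal_sub S T g :
  (forall s, S s -> germ_ideal T s) -> germ_ideal S g -> germ_ideal T g.
Proof.
move=> ST; elim=> // [|*|*|u h *]; [exact: germ_ideal0|exact: germ_idealD|exact: germ_idealM|].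
exact: (germ_ideal_div (u := u)).
Qed.

Lemma germ_ideal_sum S (I : Type) (s : seq I) (h : I -> V -> R) :
  (forall i, germ_ideal S (h i)) -> germ_ideal S (fun x => \sum_(i <- s) h i x).
Proof.
move=> Sh; elim: s => [|i s IH].
  rewrite (_ : (fun=> _) = fun=> 0); first exact: germ_ideal0.
  by apply/funext => x; rewrite big_nil.
rewrite (_ : (fun=> _) = fun x => h i x + \sum_(j <- s) h j x); first exact: germ_idealD.
by apply/funext => x; rewrite big_cons.
Qed.

End GermIdeal.

(** * The derivation D and its relation to maximal minors *)

Section Jacobian.
Set Implicit Arguments.
Unset Strict Implicit.
Variables (R : realType) (n : nat).
Local Notation V := 'rV[R]_n.+1.
Variable f : 'I_n.+1 -> V -> R.
Implicit Types (g h : V -> R) (S T : (V -> R) -> Prop) (G : seq (V -> R)).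

(** The derivation D: the argument takes the place of [f ord0], so iterating from [f ord0] gives the
    B determinants at alpha = 0. *)
Definition jac g : V -> R :=
  fun x => \det (nabla (fun a => if a == ord0 then g else f a) x).

Lemma cofactor_row0 (K : comPzRingType) (A B : 'M[K]_n.+1) j :
  row' ord0 A = row' ord0 B -> cofactor A ord0 j = cofactor B ord0 j.
Proof.
move=> AB; congr (_ * \det _); apply/matrixP => a b.
by have := congr1 (fun M : 'M[K]_(n, n.+1) => M a (lift j b)) AB; rewrite !mxE.
Qed.

Lemma nabla_row0 g x :
  row' ord0 (nabla (fun a => if a == ord0 then g else f a) x) = row' ord0 (nabla f x).
Proof. by apply/matrixP => a b; rewrite !mxE eq_sym (negbTE (neq_lift _ _)). Qed.

(** Expansion along row 0 shows a first-order differential operator whose coefficients do not depend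
    on [g]; additivity and the Leibniz rule follow. *)
Lemma jacE g x : jac g x =
  \sum_j 'D_(delta_mx ord0 j) g x * cofactor (nabla f x) ord0 j.
Proof.
rewrite /jac (expand_det_row _ ord0); apply: eq_bigr => j _.
by rewrite mxE eqxx; congr (_ * _); apply: cofactor_row0; exact: nabla_row0.
Qed.

(** The form to which [det_col_mx_eq0] applies: D g vanishes iff grad g lies in the span of the
    other gradients, when these are independent. *)
Lemma jac_col_mx g x :
  jac g x = \det (col_mx (nabla (fun=> g) x : 'rV_n.+1) (row' ord0 (nabla f x)) : 'M[R]_n.+1).
Proof.
rewrite jacE (expand_det_row _ ord0); apply: eq_bigr => j _.
congr (_ * _); first by rewrite mxE; case: splitP => [c _|c //]; rewrite mxE.
apply: cofactor_row0; apply/matrixP => a b; rewrite !mxE.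
case: splitP => [[[|//] c1] //|c /= [/val_inj ->]]; by rewrite !mxE.
Qed.

Lemma jac_eq0 k : k != ord0 -> jac (f k) = fun=> 0.
Proof.
move=> k0; apply/funext => x; apply: (determinant_alternate (i1 := ord0) (i2 := k)).
  by rewrite eq_sym.
by move=> j; rewrite !mxE eqxx (negbTE k0).
Qed.

Lemma jac0 : jac (fun=> 0) = fun=> 0.
Proof.
apply/funext => x; rewrite jacE big1 // => j _.
by rewrite (derive_cst (0 : R)) mul0r.
Qed.

Lemma jacD g h : smooth g -> smooth h ->
  jac (fun x => g x + h x) = fun x => jac g x + jac h x.
Proof.
move=> sg sh; apply/funext => x; rewrite !jacE -big_split; apply: eq_bigr => j _ /=.
by rewrite -mulrDl -deriveD //; exact: smooth_derivable.
Qed.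

Lemma jacM g h : smooth g -> smooth h ->
  jac (fun x => g x * h x) = fun x => g x * jac h x + jac g x * h x.
Proof.
move=> sg sh; apply/funext => x; rewrite !jacE mulr_sumr mulr_suml -big_split.
apply: eq_bigr => j _ /=; rewrite derive_mul; try exact: smooth_derivable.
by move: (cofactor _ _ _) => c; rewrite mulrDl (mulrAC _ (h x)) mulrA.
Qed.

Hypothesis f_smooth : forall i, smooth (f i).

Lemma smooth_jac g : smooth g -> smooth (jac g).
Proof.
move=> sg; apply: smooth_det => i j.
rewrite (_ : (fun=> _) = 'D_(delta_mx ord0 j) (if i == ord0 then g else f i)).
  by apply: smooth_derive; case: eqP.
by apply/funext => x; rewrite mxE.
Qed.

(** Induction on membership, using the Leibniz rule for multiples and for quotients. *)
Lemma germ_ideal_jac S T g :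
    (forall s, S s -> smooth s) -> (forall s, S s -> germ_ideal T s) ->
    (forall s, S s -> germ_ideal T (jac s)) ->
  germ_ideal S g -> germ_ideal T (jac g).
Proof.
move=> sS ST SjT; elim=> {g} [||g h Sg IHg Sh IHh|a g sa Sg IHg|u g su u0 sg Sug IH].
- exact: SjT.
- by rewrite jac0; exact: germ_ideal0.
- by rewrite jacD; [exact: germ_idealD|exact: germ_ideal_smooth Sg|exact: germ_ideal_smooth Sh].
- rewrite jacM //; last exact: germ_ideal_smooth Sg.
  apply: germ_idealD; first exact: germ_idealM.
  by apply: germ_idealM; [exact: smooth_jac|exact: germ_ideal_sub ST Sg].
- have Tg : germ_ideal T g by apply: germ_ideal_div su u0 sg _; exact: germ_ideal_sub ST Sug.
  apply: (germ_ideal_div su u0); first exact: smooth_jac.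
  (* The Leibniz rule solved for u D g; both terms on the right lie in the ideal of [T]. *)
  rewrite (_ : (fun=> _) = fun x => jac (fun x => u x * g x) x + (- jac u x) * g x).
    apply: germ_idealD => //; apply: germ_idealM => //.
    rewrite (_ : (fun=> _) = fun x => (-1) * jac u x).
      by apply: smoothM; [exact: smooth_cst|exact: smooth_jac].
    by apply/funext => x; rewrite mulN1r.
  by apply/funext => x; rewrite jacM // mulNr addrK.
Qed.

(** [minors] lists increasing selections only. A repeated row makes the determinant zero, and
    sorting distinct rows costs a sign; the columns are all kept in order by the identity [c]. *)
Lemma jac_minor G (s : 'I_n.+1 -> 'I_(size G)) :
  germ_ideal (fun h => h \in minors n.+1 G)
    (fun x => \det (rowsub s (nabla_tuple G x))).
Proof.
have [/injectiveP injs|/injectivePn[a [b ab sab]]] := boolP (injectiveb s); last first.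
  rewrite (_ : (fun=> _) = fun=> 0); first exact: germ_ideal0.
  apply/funext => x; apply: (determinant_alternate ab) => j.
  by rewrite !mxE sab.
have [p [t [inct st]]] := increasing_rearrangement injs.
pose c : {ffun 'I_n.+1 -> 'I_n.+1} := [ffun j => j].
rewrite (_ : (fun=> _) = fun x => (-1) ^+ p * \det (mxsub t c (nabla_tuple G x))).
  apply: germ_idealM; first exact: smooth_cst.
  apply: germ_ideal_gen; apply/allpairsP; exists (t, c); split => //.
  by apply: mem_increasing_maps => a b; rewrite !ffunE.
apply/funext => x; rewrite -det_perm -det_mulmx -row_permE; congr (\det _).
by apply/matrixP => a b; rewrite !mxE ffunE st.
Qed.

Hypothesis f_rank : \rank (row' ord0 (nabla f 0)) = n.

(** Otherwise every unit row vector, as the gradient of a coordinate, would lie in a space of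
    dimension [n]. The coordinate found completes the gradients of f_2, ..., f_n to a matrix
    invertible at 0. *)
Lemma jac_coord_neq0 : exists j0, jac (fun x => x ord0 j0) 0 != 0.
Proof.
have coord j0 : nabla (fun _ : 'I_1 => fun x : V => x ord0 j0) 0 = row j0 1%:M.
  apply/matrixP => a b; rewrite !mxE.
  have := derive_mx (@derivable_id R V 0 (delta_mx ord0 b)).
  rewrite derive_id => /matrixP/(_ ord0 j0); rewrite !mxE eqxx eq_sym => ->.
  by [].
apply: contrapT => /forallNP jac0.
suff /mxrankS : (1%:M <= row' ord0 (nabla f 0))%MS by rewrite f_rank mxrank1 ltnn.
apply/row_subP => j; rewrite -coord -det_col_mx_eq0 // -jac_col_mx.
by apply: contrapT; move/negP; exact: jac0.
Qed.

Lemma germ_ideal_minor S G (s : 'I_n.+1 -> 'I_(size G)) (t : 'I_n.+1 -> 'I_n.+1) :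
    (forall g, g \in G -> smooth g) -> (forall g, g \in G -> germ_ideal S (jac g)) ->
  germ_ideal S (fun x => \det (mxsub s t (nabla_tuple G x))).
Proof.
move=> sG SG; have [j0 u0] := jac_coord_neq0.
pose e (x : V) := x ord0 j0; have se : smooth e.
  by move=> k; apply: Ck_entry; exact: smooth_id.
pose A x := nabla (fun a => if a == ord0 then e else f a) x.
pose M x := rowsub s (nabla_tuple G x).
have sA i j : smooth (fun x => A x i j).
  rewrite (_ : (fun=> _) = 'D_(delta_mx ord0 j) (if i == ord0 then e else f i)).
    by apply: smooth_derive; case: eqP.
  by apply/funext => x; rewrite mxE.
have sM i j : smooth (fun x => M x i j).
  rewrite (_ : (fun=> _) = 'D_(delta_mx ord0 j) (tnth (in_tuple G) (s i))).
    by apply: smooth_derive; apply: sG; exact: mem_tnth.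
  by apply/funext => x; rewrite !mxE.
have sadj i j : smooth (fun x => (\adj (A x)) i j).
  rewrite (_ : (fun=> _) = fun x => cofactor (A x) j i); first exact: smooth_cofactor.
  by apply/funext => x; rewrite mxE.
have SM : germ_ideal S (fun x => \det (M x)).
  apply: (@germ_ideal_div _ _ _ (fun x => \det (\adj (A x)))).
  - exact: smooth_det.
  (* Since [A 0] times its adjugate is the scalar matrix of its determinant, a singular adjugate
     would force [\det (A 0)], which is [jac e 0], to vanish. *)
  - apply: contraNneq u0 => adj0.
    have := congr1 determinant (mul_mx_adj (A 0)).
    by rewrite det_mulmx adj0 mulr0 det_scalar => /esym/eqP; rewrite expf_eq0 => /andP[].
  - exact: smooth_det.
  (* Column 0 of the adjugate consists of the row 0 cofactors of [A], which are those of [nabla f].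
     By [jacE], column 0 of the product therefore consists of D of the selected members; the
     determinant is expanded along it. *)
  rewrite (_ : (fun=> _) = fun x => \sum_a
      cofactor (M x *m \adj (A x)) a ord0 * jac (tnth (in_tuple G) (s a)) x).
    apply: germ_ideal_sum => a; apply: germ_idealM; last by apply: SG; exact: mem_tnth.
    apply: smooth_cofactor => i j.
    rewrite (_ : (fun=> _) = fun x => \sum_k M x i k * (\adj (A x)) k j).
      by apply: smooth_sum => k; exact: smoothM.
    by apply/funext => x; rewrite mxE.
  apply/funext => x; rewrite mulrC -det_mulmx (expand_det_col _ ord0).
  apply: eq_bigr => a _; rewrite mulrC; congr (_ * _).
  rewrite mxE jacE; apply: eq_bigr => k _; rewrite !mxE; congr (_ * _).
  by apply: cofactor_row0; exact: nabla_row0.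
(* Selecting columns by [t] is right multiplication by a constant matrix, so an arbitrary [t] only
   contributes a constant factor. *)
rewrite (_ : (fun=> _) = fun x => \det (colsub t (1%:M : 'M[R]_n.+1)) * \det (M x)).
  by apply: germ_idealM => //; exact: smooth_cst.
apply/funext => x; rewrite mulrC -det_mulmx mulmx_colsub mulmx1; congr (\det _).
by apply/matrixP => a b; rewrite !mxE.
Qed.

End Jacobian.

(** * The iterated Delta tuples and the ideal of the B determinants *)

Section Jets.
Set Implicit Arguments.
Unset Strict Implicit.
Variables (R : realType) (n : nat).
Local Notation V := 'rV[R]_n.+1.
Variable f : 'I_n.+1 -> V -> R.
Hypothesis f_smooth : forall i, smooth (f i).
Hypothesis f_rank : \rank (row' ord0 (nabla f 0)) = n.
Hypothesis f_at0 : forall i, f i 0 = 0.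
Implicit Types (g h : V -> R) (G : seq (V -> R)).

Definition jet j : V -> R := iter j (jac f) (f ord0).

Definition jet_gens j h : Prop :=
  (exists2 k, k != ord0 & h = f k) \/ (exists2 i, (i <= j)%N & h = jet i).

Definition Delta1s j : seq (V -> R) := Deltas [seq f i | i <- enum 'I_n.+1] (nseq j 1%N).

(** In dimension [n.+1], index 1 gives minors of size [n.+1 - 1 + 1], the maximal ones. *)
Lemma Delta1sS j : Delta1s j.+1 = Delta1s j ++ minors n.+1 (Delta1s j).
Proof.
by rewrite /Delta1s -(addn1 j) nseqD cats1 /Deltas foldl_rcons /Delta subn1 addn1.
Qed.

Lemma smooth_jet j : smooth (jet j).
Proof. by elim: j => [|j IH] /=; [exact: f_smooth|exact: smooth_jac]. Qed.

Lemma smooth_jet_gens j h : jet_gens j h -> smooth h.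
Proof. by case=> [[k _ ->]|[i _ ->]] //; exact: smooth_jet. Qed.

Lemma jet_gensS j h : jet_gens j h -> jet_gens j.+1 h.
Proof. by case=> [|[i ij ->]]; [left|right; exists i => //; exact: leqW]. Qed.

Lemma jet_gens_eq0 j h :
  (forall i, (0 < i <= j)%N -> jet i 0 = 0) -> jet_gens j h -> h 0 = 0.
Proof. by move=> j0 [[k _ ->]//|[[|i] ij ->]]; [exact: f_at0|exact: j0]. Qed.

(** D kills f_2, ..., f_n and sends B_i to B_(i+1), so it raises the stage by one. *)
Lemma germ_ideal_jet_jac j g :
  germ_ideal (jet_gens j) g -> germ_ideal (jet_gens j.+1) (jac f g).
Proof.
apply: germ_ideal_jac => // [h|h jh|_ [[k k0 ->]|[i ij ->]]].
- exact: smooth_jet_gens.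
- exact/germ_ideal_gen/jet_gensS.
- by rewrite jac_eq0 //; exact: germ_ideal0.
- by apply: germ_ideal_gen; right; exists i.+1.
Qed.

(** One inclusion of ideals: by [germ_ideal_minor] the new minors lie in the ideal of the D g, with
    g from the previous stage. *)
Lemma Delta1s_sub_jets j g : g \in Delta1s j -> germ_ideal (jet_gens j) g.
Proof.
elim: j g => [|j IH] g.
  move=> /mapP[i _ ->]; apply: germ_ideal_gen.
  by have [->|i0] := eqVneq i ord0; [right; exists 0%N|left; exists i].
rewrite Delta1sS mem_cat => /orP[/IH|/allpairsP[[s t] [_ _ ->]]].
  by apply: germ_ideal_sub => h jh; exact/germ_ideal_gen/jet_gensS.
apply: (germ_ideal_minor f_smooth f_rank) => h /IH jh; last exact: germ_ideal_jet_jac.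
by apply: germ_ideal_smooth jh => k; exact: smooth_jet_gens.
Qed.

Lemma smooth_Delta1s j g : g \in Delta1s j -> smooth g.
Proof. by move=> /Delta1s_sub_jets; apply: germ_ideal_smooth => h; exact: smooth_jet_gens. Qed.

Lemma mem_Delta1s j i : f i \in Delta1s j.
Proof.
elim: j => [|j IH]; first by apply/map_f; rewrite mem_enum.
by rewrite Delta1sS mem_cat IH.
Qed.

(** The opposite inclusion for B_j; [mem_Delta1s] covers the components of [f]. *)
Lemma jet_sub_Delta1s j : germ_ideal (fun h => h \in Delta1s j) (jet j).
Proof.
elim: j => [|j]; first by apply: germ_ideal_gen; exact: mem_Delta1s.
apply: germ_ideal_jac => // [h|h jh|g jg].
- exact: smooth_Delta1s.
- by apply: germ_ideal_gen; rewrite Delta1sS mem_cat jh.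
(* The rows of the determinant D g are gradients of members of the tuple; [s] records their
   positions, possibly unsorted or repeated, as [jac_minor] allows. *)
have /fin_all_exists[s sE] : forall a : 'I_n.+1, exists i,
    (if a == ord0 then g else f a) = tnth (in_tuple (Delta1s j)) i.
  by move=> a; apply/tnthP; case: eqP => // _; exact: mem_Delta1s.
rewrite (_ : jac f g = fun x => \det (rowsub s (nabla_tuple (Delta1s j) x))).
  apply: germ_ideal_sub (jac_minor s) => h hm; apply: germ_ideal_gen.
  by rewrite Delta1sS mem_cat hm orbT.
apply/funext => x; congr (\det _); apply/matrixP => a b.
by rewrite !mxE sE.
Qed.

(** The row space of [K] contains that of [M], of dimension [n], so the corank is 0 or 1, and 1
    exactly when all gradients lie in the row space of [M]. Read as a number, [b] is the corank. *)
Lemma corank0_jac G (b : bool) : (forall i, f i \in G) ->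
  (b <-> forall g, g \in G -> jac f g 0 = 0) -> corank0 G = b.
Proof.
move=> fG bG; rewrite /corank0.
set K := nabla_tuple G 0; set M := row' ord0 (nabla f 0).
have rowK i : row i K = nabla (fun=> tnth (in_tuple G) i) 0.
  by apply/matrixP => a c; rewrite !mxE.
have MK : (M <= K)%MS.
  apply/row_subP => i; have /tnthP[k fk] : f (lift ord0 i) \in in_tuple G by exact: fG.
  rewrite (_ : row i M = row k K) ?row_sub //.
  by rewrite rowK -fk; apply/matrixP => a c; rewrite !mxE.
have KM : (K <= M)%MS = b.
  apply/row_subP/idP => [KM|/bG jG i].
    apply/bG => g gG; have /tnthP[i ->] : g \in in_tuple G by []; apply/eqP.
    by rewrite jac_col_mx det_col_mx_eq0 // -rowK.
  by rewrite rowK -det_col_mx_eq0 // -jac_col_mx jG // mem_tnth.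
have [] := mxrank_leqif_sup MK; rewrite f_rank KM => nK <-.
by have := rank_leq_col K; lia.
Qed.

Lemma corank0_Delta1s j : (forall i, (0 < i <= j)%N -> jet i 0 = 0) ->
  corank0 (Delta1s j) = (jet j.+1 0 == 0).
Proof.
move=> j0; apply: corank0_jac; first exact: mem_Delta1s.
split=> [/eqP jS g /Delta1s_sub_jets /germ_ideal_jet_jac|jac0].
  apply: germ_ideal_eq0 => h; apply: jet_gens_eq0 => i.
  by rewrite [(i <= _)%N]leq_eqVlt => /andP[i0 /orP[/eqP -> //|ij]]; apply: j0; rewrite i0.
(* As B_j lies in the ideal of the tuple, B_(j+1) lies in the ideal of its members and their images
   under D, all of which vanish at 0. *)
pose T h := h \in Delta1s j \/ (exists2 g, g \in Delta1s j & h = jac f g).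
apply/eqP/(@germ_ideal_eq0 _ _ T) => [h [|[g jg ->]]|]; last 1 first.
- apply: germ_ideal_jac (jet_sub_Delta1s j) => // h hj.
  + exact: smooth_Delta1s hj.
  + by apply: germ_ideal_gen; left.
  + by apply: germ_ideal_gen; right; exists h.
- by move=> /Delta1s_sub_jets; apply: germ_ideal_eq0 => k; exact: jet_gens_eq0.
- exact: jac0.
Qed.

(** The corank at step j decides B_(j+1) only once B_1, ..., B_j are known to vanish, so the
    converse recovers the jets one at a time. *)
Lemma jets_eq0P r : (forall i, (0 < i <= r)%N -> jet i 0 = 0) <->
  (forall j, (j < r)%N -> corank0 (Delta1s j) = 1%N).
Proof.
split=> [r0 j jr|cr].
  rewrite corank0_Delta1s ?r0 ?eqxx //.
  by move=> i /andP[i0 ij]; apply: r0; rewrite i0 (leq_trans ij) // ltnW.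
suff: forall j, (j <= r)%N -> forall i, (0 < i <= j)%N -> jet i 0 = 0 by apply.
elim=> [|j IH] jr i; first by case: i.
rewrite [(i <= _)%N]leq_eqVlt => /andP[i0 /orP[/eqP ->|ij]]; last first.
  by apply: IH; [exact: ltnW|rewrite i0].
have := cr _ jr; rewrite corank0_Delta1s; last by apply: IH; exact: ltnW.
by case: eqP.
Qed.

End Jets.

(** The vanishing of B_1, ..., B_r fixes the first r entries of the symbol; termination after them
    amounts to B_(r+1) being nonzero. Hence two equivalences. *)
Theorem theorem4p6 (R : realType) (n r : nat) (r_gt0 : (0 < r)%N)
    (F : 'rV[R]_n.+1 * 'rV[R]_r -> 'rV[R]_n.+1)
    (F_smooth : smooth F) (F0 : F (0, 0) = 0)
    (F_subrank : subrank F (0, 0) = n) :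
  (underlying_catastrophe F (0, 0) <->
     boardman_begins (F_at0 F) (nseq r 1%N)) /\
  (underlying_catastrophe F (0, 0) /\ Bdet F r.+1 (0, 0) <> 0 <->
     boardman_symbol (F_at0 F) (nseq r 1%N)).
Proof.
pose f (i : 'I_n.+1) (x : 'rV[R]_n.+1) := component F i (x, 0).
have f_smooth i : smooth (f i) by exact: smooth_slice_entry.
have f_at0 i : f i 0 = 0 by rewrite /f /component F0 mxE.
have f_rank : \rank (row' ord0 (nabla f 0)) = n.
  (* The matrix has [n] rows, and its rank is the term of index 0 in the minimum defining the
     subrank. *)
  apply/eqP; rewrite eqn_leq rank_leq_row /=.
  by rewrite -[X in (X <= _)%N]F_subrank /subrank big_ord_recl geq_minl.
have BdetE i x : Bdet F i (x, 0) = jet f i x.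
  elim: i x => [//|i IH] x; apply: (congr1 (fun h => \det (nabla h x))).
  apply/funext => a; apply/funext => y.
  by case: eqP => // _; exact: IH.
have catE : underlying_catastrophe F (0, 0) <->
    forall i, (0 < i <= r)%N -> jet f i 0 = 0.
  split=> [[_ B0] i ir|j0]; first by rewrite -BdetE B0.
  by split=> // i ir; rewrite BdetE j0.
have beginsE : boardman_begins (F_at0 F) (nseq r 1%N) <->
    forall j, (j < r)%N -> corank0 (Delta1s f j) = 1%N.
  split=> cr j jr.
    by have := cr j; rewrite size_nseq nth_nseq jr take_nseq ?(ltnW jr) //; apply.
  by rewrite size_nseq in jr; rewrite nth_nseq jr take_nseq ?(ltnW jr) //; exact: cr.
have catP : underlying_catastrophe F (0, 0) <->
    boardman_begins (F_at0 F) (nseq r 1%N).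
  by rewrite catE beginsE; exact: jets_eq0P.
(* The corank after r steps, one past the r ones, is governed by B_(r+1). *)
have endE : underlying_catastrophe F (0, 0) ->
    corank0 (Deltas (F_at0 F) (nseq r 1%N)) = (Bdet F r.+1 (0, 0) == 0).
  by rewrite BdetE => /catE; exact: corank0_Delta1s.
split; first exact: catP.
split=> [[cF BF]|[_ bF cF]].
  split; [by rewrite all_nseq orbT|exact/catP|].
  by rewrite endE //; case: eqP.
have uF : underlying_catastrophe F (0, 0) by exact/catP.
by split=> //; move: cF; rewrite endE //; case: eqP.
Qed.
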